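(* Let $N\ge3$, let $\Gamma=\{\gamma_n: 1\le n\le 2N-1\}\subset\mathbb R$ be a set of $2N-1$ distinct points and $\Gamma'=\{\gamma_n': 1\le n\le 2N-5\}\subset\mathbb R$ a set of $2N-5$ distinct points. Define the $N$-dimensional real vectors $$\psi_n=(1,\gamma_n,\gamma_n^2,\ldots,\gamma_n^{N-1})^T,\quad 1\le n\le 2N-1,$$ $$\tilde\psi_n=(0,1,2\gamma_n',\ldots,(N-1)(\gamma_n')^{N-2})^T,\quad 1\le n\le 2N-5.$$ Then the set $\Psi=\{\psi_n: 1\le n\le 2N-1\}\cup\{\tilde\psi_n: 1\le n\le 2N-5\}$ does conjugate phase retrieval in $\mathbb C^N$.
   Context: A set $\Psi$ of real vectors in $\mathbb R^N$ does conjugate phase retrieval in $\mathbb C^N$ if, whenever ${\bf x},{\bf y}\in\mathbb C^N$ satisfy $|\psi^T{\bf x}|=|\psi^T{\bf y}|$ for all $\psi\in\Psi$, there exists $z\in\mathbb C$ with $|z|=1$ such that ${\bf y}=z{\bf x}$ or ${\bf y}=z\overline{\bf x}$. *)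

(* Defs.v *)
From HB Require Import structures.
From mathcomp Require Import all_boot all_order all_algebra.
From mathcomp Require Import complex.
From mathcomp Require Import classical_sets reals.

Set Implicit Arguments.
Unset Strict Implicit.
Unset Printing Implicit Defensive.

Import Order.TTheory GRing.Theory Num.Theory.

Local Open Scope classical_set_scope.
Local Open Scope ring_scope.

(* Bilinear pairing: psi is real, so no conjugation is involved. *)
Definition pairing (R : realType) (N : nat) (psi : 'cV[R]_N) (x : 'cV[R[i]]_N)
    : R[i] :=
  ((map_mx (real_complex R) psi)^T *m x) ord0 ord0.

Definition conjugate_phase_retrieval (R : realType) (N : nat)
    (Psi : set 'cV[R]_N) : Prop :=
  forall x y : 'cV[R[i]]_N,
    (forall psi : 'cV[R]_N, Psi psi -> `|pairing psi x| = `|pairing psi y|) ->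
    exists z : R[i],
      `|z| = 1 /\ (y = z *: x \/ y = z *: map_mx (@conjc R) x).

Definition vander_vec (R : realType) (N : nat) (c : R) : 'cV[R]_N :=
  \col_(j < N) c ^+ j.

(* At j = 0 the truncated exponent 0.-1 is harmless: the factor j%:R is 0. *)
Definition dvander_vec (R : realType) (N : nat) (c : R) : 'cV[R]_N :=
  \col_(j < N) (j%:R * c ^+ j.-1).

(* Main.v *)
Require Import Defs.
From mathcomp Require Import all_boot all_order all_algebra.
From mathcomp Require Import complex.
From mathcomp Require Import classical_sets reals.
From mathcomp Require Import ring zify.

(** A vector [x] in C^N is the coefficient vector of a polynomial [p] of degree
    at most [N - 1]; pairing it with the two kinds of real vectors evaluates
    [p] and its derivative [p'] at real points.  Write [p*] for the polynomial
    with conjugate coefficients, so that [|p(t)|^2 = (p p* )(t)] for real [t],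
    and let [q] be the polynomial of the other vector [y].

    The [2N - 1] values of [|p| = |q|] determine a polynomial of degree at most
    [2N - 2], whence [p p* = q q*].  This equality already forces the two top
    coefficients of [p' p*'] and [q' q*'], in degrees [2N - 4] and [2N - 5], to
    agree, so that the [2N - 5] remaining values suffice to get
    [p' p*' = q' q*'] (lemma [size_deriv_mul_diff]).

    Differentiating [p p* = q q*] now shows that the pairs [(p' p*, p p*')] and
    [(q' q*, q q*')] have the same sum, and by the above the same product.
    Hence they agree up to order, as the roots of one quadratic over an
    integral domain (lemma [mul_deriv_mul_proportional]).  According to the
    order, [p' q = p q'] or [p' q* = p q*'], i.e. a Wronskian vanishes, and in
    characteristic 0 this means that [q] or [q*] is a scalar multiple of [p]
    (lemma [deriv_mul_proportional]).  The scalar has modulus 1 since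
    [p p* = q q*]. *)

Set Implicit Arguments.
Unset Strict Implicit.
Unset Printing Implicit Defensive.

Import Order.TTheory GRing.Theory Num.Theory.

Local Open Scope classical_set_scope.
Local Open Scope ring_scope.

(** * Polynomials with vanishing Wronskian *)

(** The coefficient of [p' q - p q'] in the highest possible degree is the
    difference of the degrees times the product of the leading coefficients. *)
Lemma size_eq_deriv_mul (F : numFieldType) (p q : {poly F}) :
  p != 0 -> q != 0 -> p^`() * q = p * q^`() -> size p = size q.
Proof.
move=> p0 q0 /(congr1 (fun r => 'X * r)).
have pS : size p = (size p).-1.+1 by rewrite prednK ?size_poly_gt0.
have qS : size q = (size q).-1.+1 by rewrite prednK ?size_poly_gt0.
set m := (size p).-1 in pS; set n := (size q).-1 in qS.
(* Multiplying a derivative by ['X] keeps the degree bound, so that top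
   coefficients can be read off without truncated subtraction. *)
have XderivE (r : {poly F}) k : ('X * r^`())`_k = r`_k *+ k.
  by rewrite coefXM; case: k => [|k] /=; rewrite ?mulr0n ?coef_deriv.
have szX (r : {poly F}) k : size r = k.+1 -> (size ('X * r^`())%R <= k.+1)%N.
  by move=> rk; apply/leq_sizeP => j kj; rewrite XderivE nth_default ?mul0rn ?rk.
have top (a b : {poly F}) : (size a <= m.+1)%N -> (size b <= n.+1)%N ->
    (a * b)`_(m + n) = a`_m * b`_n.
  move=> sa sb; rewrite coefM.
  have mlt : (m < (m + n).+1)%N by lia.
  rewrite (bigD1 (Ordinal mlt)) //= addKn big1 ?addr0 // => -[i ilt] /=.
  rewrite -val_eqE /= => inm.
  have [im|im] := ltnP i m; first
    by rewrite [b`__]nth_default ?mulr0 // (leq_trans sb) //; lia.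
  by rewrite nth_default ?mul0r // (leq_trans sa) //; lia.
rewrite mulrA (mulrCA 'X) => /(congr1 (fun r : {poly F} => r`_(m + n))).
rewrite !top ?pS ?qS ?leqnn ?szX // !XderivE mulrnAl mulrnAr => eq_mn.
congr _.+1; apply: mulrIn eq_mn.
by rewrite mulf_eq0 negb_or -!lead_coefE !lead_coef_eq0 p0 q0.
Qed.

(** The multiple of [p] that cancels the leading coefficient of [q] leaves a
    remainder of smaller size than [p] whose Wronskian with [p] still
    vanishes; [size_eq_deriv_mul] then forces this remainder to be 0. *)
Lemma deriv_mul_proportional (F : numFieldType) (p q : {poly F}) :
  p != 0 -> p^`() * q = p * q^`() -> exists c, q = c *: p.
Proof.
move=> p0 W; have [->|q0] := eqVneq q 0; first by exists 0; rewrite scale0r.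
have sz := size_eq_deriv_mul p0 q0 W.
pose c := lead_coef q / lead_coef p; exists c.
apply/eqP; rewrite -subr_eq0; apply/negPn/negP => r0.
have Wr : p^`() * (q - c *: p) = p * (q - c *: p)^`().
  rewrite derivB derivZ !mulrBr W -!scalerAr.
  by rewrite [p^`() * p]mulrC.
have := size_eq_deriv_mul p0 r0 Wr; apply/eqP; rewrite neq_ltn; apply/orP; right.
rewrite -[X in (_ < X)%N]prednK ?size_poly_gt0 // ltnS; apply/leq_sizeP => j.
rewrite leq_eqVlt => /orP[/eqP <-|]; rewrite coefB coefZ.
  by rewrite {1}sz -!lead_coefE divfK ?subrr ?lead_coef_eq0.
rewrite prednK ?size_poly_gt0 // => pj.
by rewrite !nth_default ?mulr0 ?subrr -?sz.
Qed.

(** * Products of polynomials and of their derivatives *)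

(** The pairs [(p' ps, p ps')] and [(q' qs, q qs')] have the same sum (the
    derivative of [p ps]) and the same product, hence agree up to order. *)
Lemma mul_deriv_mul_proportional (F : numFieldType) (p ps q qs : {poly F}) :
    p != 0 -> ps != 0 ->
    p * ps = q * qs -> p^`() * ps^`() = q^`() * qs^`() ->
  (exists c, q = c *: p) \/ (exists c, qs = c *: p).
Proof.
move=> p0 ps0 e0 e1; have /(congr1 (@deriv F)) := e0; rewrite !derivM => e2.
have : (p^`() * ps - q^`() * qs) * (p^`() * ps - q * qs^`()) = 0.
  transitivity (p^`() * ps * (p^`() * ps + p * ps^`()
                              - (q^`() * qs + q * qs^`()))
                + ((q * qs) * (q^`() * qs^`()) - (p * ps) * (p^`() * ps^`()))).
    by ring.
  by rewrite e2 e0 e1 !subrr mulr0 addr0.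
move/eqP; rewrite mulf_eq0 !subr_eq0 => /orP[] /eqP e; [left|right].
  apply: (deriv_mul_proportional p0); apply: (mulIf ps0).
  by rewrite mulrAC e mulrAC -mulrA -e0 mulrA [q^`() * p]mulrC.
apply: (deriv_mul_proportional p0); apply: (mulIf ps0).
by rewrite mulrAC e mulrAC -e0 mulrAC.
Qed.

(** For [n] bounding the degree of [p], put [D p := n p - X p'], which has
    degree less than [n].  Expanding, [X^2 p' ps'] differs from [D p * D ps] by
    an expression in [p ps] and its derivative only, so that
    [X^2 (p' ps' - q' qs')] is equal to [D p * D ps - D q * D qs].
    This has degree at most [2n - 2], two less than the naive bound for
    [X^2 p' ps']. *)
Lemma size_deriv_mul_diff (F : idomainType) (n : nat) (p ps q qs : {poly F}) :
    (size p <= n.+1)%N -> (size ps <= n.+1)%N ->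
    (size q <= n.+1)%N -> (size qs <= n.+1)%N -> p * ps = q * qs ->
  (size (p^`() * ps^`() - q^`() * qs^`())%R <= n.*2 - 3)%N.
Proof.
move=> sp sps sq sqs e0.
pose D (r : {poly F}) := r *+ n - r^`() * 'X.
have sD (r : {poly F}) : (size r <= n.+1)%N -> (size (D r) <= n)%N.
  move=> sr; apply/leq_sizeP => j nj; rewrite coefB coefMn coefMX.
  have [jn|jn] := eqVneq j n.
    by case: j jn {nj} => [|j] <-; rewrite ?mulr0n ?subrr // coef_deriv subrr.
  have nltj : (n < j)%N by rewrite ltn_neqAle eq_sym jn.
  case: j {jn nj} nltj => // j nltj; rewrite coef_deriv /=.
  by rewrite nth_default ?mul0rn ?subrr // (leq_trans sr).
have sDD (r s : {poly F}) : (size r <= n.+1)%N -> (size s <= n.+1)%N ->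
    (size (D r * D s)%R <= n.*2.-1)%N.
  move=> /sD sr /sD ss; apply: leq_trans (size_polyMleq _ _) _; lia.
have e2 := congr1 (@deriv F) e0; rewrite !derivM in e2.
have DE r s : D r * D s = (r * s) *+ n *+ n - (r^`() * s + r * s^`()) * 'X *+ n
    + (r^`() * s^`()) * 'X^2.
  rewrite /D; move: r^`() s^`() => dr ds.
  by rewrite mulrBl !mulrBr !mulrnAl !mulrnAr; move: ('X : {poly F}) => X; ring.
have key : (p^`() * ps^`() - q^`() * qs^`()) * 'X^2 = D p * D ps - D q * D qs.
  by rewrite !DE e0 e2 opprD addrACA subrr add0r mulrBl.
have [->|h0] := eqVneq (p^`() * ps^`() - q^`() * qs^`()) 0.
  by rewrite size_poly0.
have shift2 k : (2 + k <= n.*2.-1)%N -> (k <= n.*2 - 3)%N by lia.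
apply: shift2; rewrite -size_mulXn // key.
by rewrite (leq_trans (size_polyD _ _)) // size_polyN geq_max !sDD.
Qed.

Lemma poly_eq0_of_inj_roots (F : idomainType) (m : nat) (f : 'I_m -> F)
    (p : {poly F}) :
  injective f -> (size p <= m)%N -> (forall i, root p (f i)) -> p = 0.
Proof.
move=> f_inj sp rt; apply: (@roots_geq_poly_eq0 _ p (codom f)).
- by apply/allP => _ /codomP[i ->].
- by rewrite map_inj_uniq ?enum_uniq.
- by rewrite size_codom card_ord.
Qed.

(** * Vectors as polynomials *)

Section VectorPolynomial.

Variable R : realType.
Implicit Types (p : {poly R[i]}) (t : R).

Local Notation conj_poly := (map_poly (@conjc R)).

Lemma sqr_norm_horner_real p t :
  `|p.[t%:C%C]| ^+ 2 = (p * conj_poly p).[t%:C%C].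
Proof.
rewrite sqr_normc hornerM; congr (_ * _).
by rewrite -[in RHS](conjc_real t) horner_map.
Qed.

Section FixedDimension.

Variable N : nat.
Implicit Type x : 'cV[R[i]]_N.

Lemma rVpoly_sumE x : rVpoly x^T = \sum_(j < N) x j 0 *: 'X^j.
Proof.
rewrite {1}[x^T]row_sum_delta linear_sum; apply: eq_bigr => j _.
by rewrite linearZ /= rVpoly_delta mxE.
Qed.

Lemma pairing_vander x t : pairing (vander_vec N t) x = (rVpoly x^T).[t%:C%C].
Proof.
rewrite rVpoly_sumE horner_sum /pairing mxE; apply: eq_bigr => j _.
by rewrite !mxE !hornerE rmorphXn mulrC.
Qed.

Lemma pairing_dvander x t :
  pairing (dvander_vec N t) x = (rVpoly x^T)^`().[t%:C%C].
Proof.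
rewrite rVpoly_sumE linear_sum horner_sum /pairing mxE; apply: eq_bigr => j _.
rewrite !mxE linearZ /= derivXn !hornerE hornerMn !hornerE.
by rewrite rmorphM rmorph_nat rmorphXn mulrC mulr_natl.
Qed.

Lemma conj_rVpoly x : conj_poly (rVpoly x^T) = rVpoly (map_mx (@conjc R) x)^T.
Proof.
by apply/polyP => k; rewrite coef_map /= !coef_rVpoly; case: insub => [i|];
  rewrite ?mxE ?rmorph0.
Qed.

Lemma rVpoly_trmx_inj : injective (fun x => rVpoly x^T).
Proof. by move=> x y /(can_inj rVpolyK)/trmx_inj. Qed.

End FixedDimension.

(** If [q = c p], then [q q* = |c|^2 p p*], and [p p*] is nonzero. *)
Lemma norm1_of_scale p (c : R[i]) : p != 0 ->
  p * conj_poly p = (c *: p) * conj_poly (c *: p) -> `|c| = 1.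
Proof.
move=> p0; have ps0 : conj_poly p != 0 by rewrite map_poly_eq0.
rewrite map_polyZ -scalerAl -scalerAr scalerA -sqr_normc => /eqP.
rewrite -[X in X == _]scale1r -subr_eq0 -scalerBl scaler_eq0 mulf_eq0.
rewrite (negPf p0) (negPf ps0) !orbF subr_eq0 eq_sym sqrf_eq1 => /orP[] /eqP //.
by move=> c1; have := normr_ge0 c; rewrite c1 oppr_ge0 ler10.
Qed.

End VectorPolynomial.

(** * Conjugate phase retrieval *)

Theorem lemma4p2 (R : realType) (N : nat) (hN : (3 <= N)%N)
    (gamma : 'I_(2 * N - 1) -> R) (gamma' : 'I_(2 * N - 5) -> R)
    (gamma_inj : injective gamma) (gamma'_inj : injective gamma') :
  conjugate_phase_retrieval
    ([set vander_vec N (gamma n) | n in [set: 'I_(2 * N - 1)]] `|`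
     [set dvander_vec N (gamma' n) | n in [set: 'I_(2 * N - 5)]]).
Proof.
move=> x y mag.
pose p := rVpoly x^T; pose q := rVpoly y^T.
pose cj := map_poly (@conjc R).
have cC_inj : injective (real_complex R) by move=> a b [].
have szp (v : 'cV[R[i]]_N) : (size (rVpoly v^T) <= N.-1.+1)%N.
  by rewrite (leq_trans (size_poly _ _)) //; lia.
have szc (v : 'cV[R[i]]_N) : (size (cj (rVpoly v^T)) <= N.-1.+1)%N.
  by rewrite size_map_poly.
have szM (v : 'cV[R[i]]_N) :
    (size (rVpoly v^T * cj (rVpoly v^T))%R <= 2 * N - 1)%N.
  by apply: leq_trans (size_polyMleq _ _) _; have := szp v; have := szc v; lia.
have e0 : p * cj p = q * cj q.
  apply/eqP; rewrite -subr_eq0; apply/eqP.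
  apply: (poly_eq0_of_inj_roots (inj_comp cC_inj gamma_inj)).
    apply: leq_trans (size_polyD _ _) _.
    by rewrite size_polyN geq_max !szM.
  move=> i /=; rewrite rootE hornerD hornerN -!sqr_norm_horner_real.
  rewrite -!pairing_vander mag ?subrr //.
  by left; exists i.
have e1 : p^`() * (cj p)^`() = q^`() * (cj q)^`().
  apply/eqP; rewrite -subr_eq0; apply/eqP.
  apply: (poly_eq0_of_inj_roots (inj_comp cC_inj gamma'_inj)).
    apply: leq_trans (size_deriv_mul_diff (szp x) (szc x) (szp y) (szc y) e0) _.
    by lia.
  move=> i /=; rewrite /cj !deriv_map rootE hornerD hornerN.
  rewrite -!sqr_norm_horner_real -!pairing_dvander mag ?subrr //.
  by right; exists i.
have [p0|p0] := eqVneq p 0.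
  (* Then [q q* = 0], so [x = y = 0] and any [z] of modulus 1 will do. *)
  exists 1; rewrite normr1; split=> //; left.
  move: e0; rewrite p0 mul0r => /esym/eqP.
  rewrite mulf_eq0 map_poly_eq0 orbb => /eqP q0.
  by rewrite scale1r; apply: rVpoly_trmx_inj; rewrite /= -/p -/q p0 q0.
have ps0 : cj p != 0 by rewrite map_poly_eq0.
have [[c qE]|[c qE]] := mul_deriv_mul_proportional p0 ps0 e0 e1.
  exists c; split; first by apply: (norm1_of_scale p0); rewrite -qE.
  by left; apply: rVpoly_trmx_inj; rewrite /= !linearZ.
(* Here [q* = c p]; conjugating gives [q = c^* p*]. *)
have c1 : `|c| = 1.
  apply: (norm1_of_scale p0); rewrite -qE e0 mulrC; congr (_ * _).
  by apply/polyP => k; rewrite !coef_map /= conjcK.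
exists (conjc c); split; first by rewrite normcJ.
right; apply: rVpoly_trmx_inj; rewrite /= !linearZ /= -conj_rVpoly -map_polyZ.
rewrite -/p -/cj -qE.
by apply/polyP => k; rewrite !coef_map /= conjcK.
Qed.
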